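(* There is an absolute constant $C>0$ such that for all integers $n\ge m\ge 1$ with $n\ge 2$, writing $u=n/m$, $$\rho(u)\exp\left(-C\,\frac{u\log(u+1)}{m}\right)\le\mathbb{P}(\pi_n\text{ is }m\text{-smooth})\le\rho(u)\exp\left(C\,\frac{u\log(u+1)}{m}\right).$$
   Context: $\log$ is the natural logarithm. $\pi_n$ is a uniformly random permutation in the symmetric group $S_n$; a permutation is $m$-smooth if all its cycles have length at most $m$. $\rho:[0,\infty)\to(0,1]$ is the Dickman function: the continuous function with $\rho(t)=1$ for $t\in[0,1]$ and $t\rho'(t)+\rho(t-1)=0$ for $t>1$. *)

(* Defs.v *)
From HB Require Import structures.
From mathcomp Require Import all_boot all_order all_algebra all_fingroup.
From mathcomp Require Import all_classical all_reals all_analysis.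

Set Implicit Arguments.
Unset Strict Implicit.
Unset Printing Implicit Defensive.

Import Order.TTheory GRing.Theory Num.Theory.
Import numFieldNormedType.Exports.

Local Open Scope classical_set_scope.
Local Open Scope ring_scope.

(* [porbits s] contains the fixed points of [s] as singletons, so every cycle
   of the cycle decomposition is taken into account. *)
Definition smooth_perm (m n : nat) (s : 'S_n) : bool :=
  [forall c in porbits s, (#|c| <= m)%N].

Definition uniform_prob (R : realType) (T : finType) (P : pred T) : R :=
  #|P|%:R / #|T|%:R.

Definition prob_smooth (R : realType) (n m : nat) : R :=
  uniform_prob R (@smooth_perm m n).

(* The Dickman function is total on [R] here; nothing is required of its values
   at negative arguments. The derivative at [t > 1] is two-sided; none is
   required at [t = 1], where it does not exist. *)
Record is_dickman (R : realType) (rho : R -> R) : Prop := IsDickman {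
  dickman_range : forall t : R, 0 <= t -> 0 < rho t <= 1 ;
  dickman_continuous : {within [set t : R | 0 <= t], continuous rho} ;
  dickman_eq1 : forall t : R, 0 <= t <= 1 -> rho t = 1 ;
  dickman_derivable : forall t : R, 1 < t -> derivable rho t 1 ;
  dickman_eq : forall t : R, 1 < t -> t * derive1 rho t + rho (t - 1) = 0
}.

(* Main.v *)
Require Import Defs.
From HB Require Import structures.
From mathcomp Require Import all_boot all_order all_algebra all_fingroup.
From mathcomp Require Import all_classical all_reals all_analysis.
From mathcomp Require Import ring lra zify.

Import Order.TTheory GRing.Theory Num.Theory.
Import numFieldNormedType.Exports.

(** Write p(n, m) for the probability that a random permutation of n points is
m-smooth. Conditioning on the length of the cycle of a fixed point gives
  n p(n, m) = p(n-1, m) + ... + p(n-m, m)   for n >= m, p(n, m) = 1 for n <= m,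
while the Dickman equation integrates to t rho(t) = int_(t-1)^t rho for t >= 1.
Sampling at t = n/q turns the integral into q pieces of length 1/q, and since
rho is nonincreasing it lies between its two Riemann sums. With q = m, the upper
sum shows that rho(n/m) satisfies the recurrence of p with <= in place of =.
With q = m+1, the lower sum has m+1 terms, one of which is rho(n/(m+1)) itself;
dropping that term leaves the recurrence of p with >= in place of =. Induction
on n then gives the sandwich
  rho(n/m) <= p(n, m) <= rho(n/(m+1))       for all n >= 0 and m >= 1
([dickman_le_smooth], [smooth_le_dickman]). The lower bound of the theorem is the
left half of the sandwich.

For the upper bound, rho(n/(m+1)) has to be compared with rho(n/m). This is a
statement about the logarithmic derivative of rho, and it is proved on the
discrete side. The sequence p(., M) is log-concave
([drop_ratio_nondecreasing]): the ratio a(k) = p(k, M) / p(k+1, M) satisfies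
1 / (a(n+M) - 1) = sum_(i < M) p(n+1+i, M) / p(n, M), which involves only smaller
values of a, so monotonicity follows by strong induction. Log-concavity bounds
a(k)^k by p(k, M) / p(2k, M), and the crude bound
p(N, M) >= (2N/M)^(-2N/M) ([smooth_lower]) turns this into
a(k) <= exp((8/M) log(k/M + 1)) for k >= M ([drop_ratio_le]).

The sandwich transfers this to rho. Take M = (2m-1)(m+1), so that
M + 1 = m(2m+1). Then n/(m+1) = n(2m-1)/M and n/m = n(2m+1)/(M+1), so with
N = n(2m-1)
  p(n, m) <= rho(n/(m+1)) <= p(N, M) <= a(N+2n)^(2n) p(N+2n, M)
          <= a(N+2n)^(2n) rho(n/m).
Since M >= 2m^2, the factor is at most exp(16 u log(u+1) / m) with u = n/m. *)

Set Implicit Arguments.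
Unset Strict Implicit.
Unset Printing Implicit Defensive.

(** * Peeling points off a cycle *)

Section Cycles.
Local Open Scope group_scope.
Variables (T : finType).
Implicit Types (s t : {perm T}) (A : {set T}) (x y z : T).

Lemma porbit_sub s x A :
  x \in A -> {in A, forall z, s z \in A} -> porbit s x \subset A.
Proof.
move=> xA sA; apply/fintype.subsetP => _ /porbitP[i ->]; rewrite permX.
by elim: i => //= i; apply: sA.
Qed.

Lemma porbit_next s x z : z \in porbit s x -> s z \in porbit s x.
Proof. by move=> /porbitP[i ->]; rewrite -permM -expgSr mem_porbit. Qed.

Lemma eq_in_porbit s t x :
  {in porbit s x, s =1 t} -> porbit t x = porbit s x.
Proof.
move=> st; have tX i : (t ^+ i) x = (s ^+ i) x.
  elim: i => [|i IH]; first by rewrite !perm1.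
  by rewrite !expgSr !permM IH -st // mem_porbit.
by apply/finset.setP => z; apply/porbitP/porbitP => -[i ->]; exists i; rewrite tX.
Qed.

(** If [t] fixes [y], then [tperm x y * t] sends [x] to [y] and [y] to [t x]: it
inserts [y] into the cycle of [x], just after [x]. Every permutation moving [x]
arises in this way from a unique [y] and [t], which is how cycles are shortened
one point at a time in [card_pointed_onS]. *)
Lemma porbit_tperm_mul t x y : t y = y -> x != y ->
  porbit (tperm x y * t) x = y |: porbit t x.
Proof.
move=> ty xy; set s := tperm x y * t.
have sx : s x = y by rewrite permM tpermL.
have sy : s y = t x by rewrite permM tpermR.
have sD z : z != x -> z != y -> s z = t z.
  by move=> zx zy; rewrite permM tpermD // eq_sym.
apply/eqP; rewrite finset.eqEsubset; apply/andP; split.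
  apply: porbit_sub => [|z]; first by rewrite !inE porbit_id orbT.
  rewrite 2!inE; have [-> _|zy] /= := eqVneq z y.
    by rewrite sy !inE porbit_next ?porbit_id ?orbT.
  have [-> _|zx] := eqVneq z x; first by rewrite sx !inE eqxx.
  by move=> zt; rewrite sD // !inE porbit_next ?orbT.
rewrite finset.subUset finset.sub1set -{1}sx porbit_next ?porbit_id //=.
apply: porbit_sub => [|z zs]; first exact: porbit_id.
have [->|zy] := eqVneq z y; first by rewrite ty -sx porbit_next ?porbit_id.
have [->|zx] := eqVneq z x; first by rewrite -sy -sx !porbit_next ?porbit_id.
by rewrite -sD // porbit_next.
Qed.

Lemma porbit_tperm_mulD t x y z : t y = y -> x != y ->
  z \notin y |: porbit t x -> porbit (tperm x y * t) z = porbit t z.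
Proof.
move=> ty xy; rewrite !inE negb_or => /andP[zy zx].
apply: eq_in_porbit => w wz; rewrite permM tpermD //.
  by apply: contraNneq zx => ->; rewrite porbit_sym.
apply: contraNneq zy => yw; move: wz; rewrite -yw porbit_sym => /porbitP[i ->].
by rewrite permX; elim: i => //= i /eqP ->; rewrite ty.
Qed.

Definition smooth_off (m : nat) s x : bool :=
  [forall z, (z \in porbit s x) || (#|porbit s z| <= m)%N].

(** Permutations of a subset [A] are encoded as permutations of the whole type
supported in [A]. The points outside [A] are then fixed points, which never break
smoothness since [m > 0], and removing a point from a permutation does not change
its type. *)
Definition smooth_on (m : nat) A : {set {perm T}} :=
  [set s | perm_on A s & [forall x, #|porbit s x| <= m]].

Definition pointed_on (m : nat) A x (j : nat) : {set {perm T}} :=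
  [set s | [&& perm_on A s, smooth_off m s x & #|porbit s x| == j]].

Lemma smooth_off_tperm m t x y : t y = y -> x != y ->
  (0 < m)%N -> smooth_off m (tperm x y * t) x = smooth_off m t x.
Proof.
move=> ty xy m0; apply/eq_forallb => z; rewrite porbit_tperm_mul //.
have [|zn] := boolP (z \in y |: porbit t x); last first.
  rewrite porbit_tperm_mulD //; move: zn.
  by rewrite !inE negb_or => /andP[_ /negPf->].
rewrite 2!inE => /predU1P[-> | ->] //.
suff -> : porbit t y = [set y] by rewrite cards1 m0 orbT.
apply/eqP; rewrite finset.eqEsubset finset.sub1set porbit_id andbT.
by apply: porbit_sub => [|z0]; rewrite ?inE // => /eqP->; rewrite ty.
Qed.

Lemma card_porbit_tperm t x y : t y = y -> x != y ->
  #|porbit (tperm x y * t) x| = #|porbit t x|.+1.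
Proof.
move=> ty xy; rewrite porbit_tperm_mul // cardsU1.
suff -> : y \notin porbit t x by [].
rewrite porbit_sym; apply: contra xy => /porbitP[i ->].
by apply/eqP; rewrite permX; elim: i => //= i ->.
Qed.

Lemma card_smooth_on m A x :
  #|smooth_on m A| = (\sum_(j < m) #|pointed_on m A x j.+1|)%N.
Proof.
have smE s : s \in smooth_on m A =
    [&& perm_on A s, smooth_off m s x & (#|porbit s x| <= m)%N].
  rewrite inE; case: (perm_on A s) => //=; apply/forallP/andP => [h|[]].
    by split=> //; apply/forallP => z; rewrite h orbT.
  move=> /forallP h1 h2 z; case/orP: (h1 z) => // zx.
  by move: zx; rewrite -eq_porbit_mem => /eqP->.
transitivity (\sum_(s in smooth_on m A) \sum_(j < m) (#|porbit s x| == j.+1)%N)%N.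
  rewrite -sum1_card; apply: eq_bigr => s; rewrite smE => /and3P[_ _ sm].
  case sj: #|_| (card_porbit_neq0 s x) sm => [//|j] _ jm.
  rewrite (bigD1 (Ordinal jm)) //= eqxx big1 // => i /negPf ij.
  by rewrite eqSS; apply/eqP; rewrite eqb0; apply/negP => /eqP ji;
     move/eqP: ij; apply; apply: val_inj.
rewrite exchange_big; apply: eq_bigr => j _.
rewrite -sum1_card big_mkcond [RHS]big_mkcond; apply: eq_bigr => s _.
rewrite smE !inE; case: (perm_on A s) => //=; case: smooth_off => //=.
by case: eqP => [->|_]; [rewrite ltn_ord | case: ifP].
Qed.

Lemma pointed_on1 m A x : (0 < m)%N -> x \in A ->
  pointed_on m A x 1%N = smooth_on m (A :\ x).
Proof.
move=> m0 xA; apply/finset.setP => s; rewrite !inE.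
apply/and3P/andP => [[sA /forallP so /eqP s1]|[sA /forallP so]].
  have px : porbit s x = [set x].
    by apply/esym/eqP; rewrite eqEcard cards1 s1 finset.sub1set porbit_id.
  split.
    apply/fintype.subsetP => z sz; rewrite !inE (fintype.subsetP sA) // andbT.
    move: sz; rewrite inE; apply: contraNneq => ->.
    by have := porbit_next (porbit_id s x); rewrite px inE.
  apply/forallP => z; case/orP: (so z) => //; rewrite px inE => /eqP->.
  by rewrite px cards1.
have sx : s x = x by rewrite (out_perm sA) // !inE eqxx.
split.
- by apply: fintype.subset_trans sA _; rewrite finset.subsetDl.
- by apply/forallP => z; rewrite so orbT.
- suff -> : porbit s x = [set x] by rewrite cards1.
  apply/eqP; rewrite finset.eqEsubset finset.sub1set porbit_id andbT.
  by apply: porbit_sub => [|z0]; rewrite ?inE // => /eqP->; rewrite sx.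
Qed.

(** The successor [y] of [x] is any of the other points of [A]; cutting [y] out of
the cycle of [x] shortens it by one and leaves the other cycles alone. *)
Lemma card_pointed_onS m A x j : (0 < m)%N -> x \in A -> (0 < j)%N ->
  #|pointed_on m A x j.+1| =
  (\sum_(y in A :\ x) #|pointed_on m (A :\ y) x j|)%N.
Proof.
move=> m0 xA j0.
have mE y t : y \in A :\ x -> t y = y ->
  (tperm x y * t \in pointed_on m A x j.+1) = (t \in pointed_on m (A :\ y) x j).
  rewrite !inE eq_sym => /andP[xy yA] ty.
  rewrite smooth_off_tperm // card_porbit_tperm // eqSS; congr (_ && _).
  apply/idP/idP => tA; apply/fintype.subsetP => z; rewrite inE => tz.
    have zy : z != y by apply: contraNneq tz => ->; rewrite ty.
    rewrite !inE zy /=; have [->|zx] := eqVneq z x; first by [].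
    by apply: (fintype.subsetP tA); rewrite inE permM tpermD // eq_sym.
  have [->|zx] := eqVneq z x; first by [].
  have [->|zy] := eqVneq z y; first by [].
  have := fintype.subsetP tA z; rewrite !inE => /(_ _) /andP[] //.
  by move: tz; rewrite permM tpermD // eq_sym.
rewrite -sum1_card (partition_big (fun s : {perm T} => s x) (mem (A :\ x))) /=.
  apply: eq_bigr => y yAx; rewrite -sum1_card.
  rewrite (reindex_onto (fun t => tperm x y * t) (fun s => tperm x y * s)) /=.
    apply: eq_bigl => t; rewrite mulgA tperm2 mul1g eqxx andbT permM tpermL.
    have [ty|ty] := eqVneq (t y) y; first by rewrite andbT mE.
    rewrite andbF; apply/esym/negP; rewrite inE => /and3P[tA _ _].
    by move/eqP: ty; apply; rewrite (out_perm tA) // !inE eqxx.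
  by move=> s _; rewrite mulgA tperm2 mul1g.
move=> s; rewrite inE => /and3P[sA _ /eqP sj]; rewrite !inE perm_closed // xA.
rewrite andbT; apply/negP => /eqP sx; move: sj.
suff -> : porbit s x = [set x] by rewrite cards1; case: j j0 {mE}.
apply/eqP; rewrite finset.eqEsubset finset.sub1set porbit_id andbT.
by apply: porbit_sub => [|z0]; rewrite ?inE // => /eqP->; rewrite sx.
Qed.

End Cycles.

(** Iterating [card_pointed_onS], the points following [x] on its cycle form an
ordered list of [j] distinct points, and the rest of [A] carries an arbitrary
smooth permutation. Counting the latter by a function [g] of the size alone is
the induction hypothesis of [card_smooth_on_eq]; when the cycle is too long for
[A] both sides vanish because the falling factorial does. *)
Lemma card_pointed_on m (g : nat -> nat) k : (0 < m)%N ->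
  (forall (T : finType) (A : {set T}), (#|A| <= k)%N -> #|smooth_on m A| = g #|A|) ->
  forall j (T : finType) (A : {set T}) x, x \in A -> (#|A| <= k.+1)%N ->
  #|pointed_on m A x j.+1| = (#|A|.-1 ^_ j * g (#|A|.-1 - j))%N.
Proof.
move=> m0 gE; elim=> [|j IH] T A x xA Ak.
  have cA : #|A :\ x| = #|A|.-1 by rewrite (cardsD1 x A) xA.
  by rewrite pointed_on1 // ffactn0 mul1n subn0 gE cA // -ltnS prednK // (cardsD1 x A) xA.
rewrite card_pointed_onS // ffactnS.
rewrite (eq_bigr (fun=> (#|A|.-1.-1 ^_ j * g (#|A|.-1 - j.+1))%N)).
  by rewrite sum_nat_const (cardsD1 x A) xA /= mulnA.
move=> y; rewrite !inE => /andP[yx yA].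
have cA : #|A :\ y| = #|A|.-1 by rewrite (cardsD1 y A) yA.
rewrite IH ?cA // ?inE ?(eq_sym x) ?yx //; last exact: leq_trans (leq_pred _) Ak.
by congr (_ * g _)%N; rewrite -subn1 -subnDA add1n.
Qed.

Definition smooth_count m n := #|smooth_on m [set: 'I_n]|.

Lemma card_smooth_on_eq m (T : finType) (A : {set T}) : (0 < m)%N ->
  #|smooth_on m A| = smooth_count m #|A|.
Proof.
move=> m0; move: {2}#|A| (leqnn #|A|) => k.
elim: k T A => [|k IH] T A; last first.
  move=> Ak; have [A0|/finset.set0Pn[x xA]] := eqVneq A finset.set0.
    by apply: IH; rewrite A0 cards0.
  have /prednK cA : (0 < #|A|)%N by rewrite (cardsD1 x) xA.
  rewrite /smooth_count -cA (card_smooth_on _ _ x) (card_smooth_on _ _ ord0).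
  by apply: eq_bigr => j _; rewrite !(card_pointed_on m0 IH) ?inE // cardsT card_ord cA.
have only1 (S : finType) : #|smooth_on m (@finset.set0 S)| = 1%N.
  rewrite -(cards1 (1%g : {perm S})); congr #|pred_of_set _|; apply/finset.setP => s.
  rewrite !inE; apply/andP/eqP => [[s0 _]|->].
    by apply/permP => z; rewrite perm1 (out_perm s0) ?inE.
  split; first exact: perm_on1.
  apply/forallP => z; suff -> : porbit 1%g z = [set z] by rewrite cards1.
  by apply/finset.setP => w; rewrite porbit.unlock cycle1 imset_set1 /aperm perm1.
rewrite leqn0 cards_eq0 => /eqP->; rewrite cards0 only1 /smooth_count.
by rewrite (_ : [set: _] = finset.set0) ?only1 //; apply/finset.setP => -[].
Qed.

Lemma smooth_countS m n : (0 < m)%N ->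
  smooth_count m n.+1 = (\sum_(j < m) n ^_ j * smooth_count m (n - j))%N.
Proof.
move=> m0; rewrite {1}/smooth_count (card_smooth_on _ _ ord0).
apply: eq_bigr => j _.
rewrite (@card_pointed_on m (smooth_count m) n) ?inE ?cardsT ?card_ord //.
by move=> T A _; apply: card_smooth_on_eq.
Qed.

Local Open Scope classical_set_scope.
Local Open Scope ring_scope.

(** * The recurrence for smooth permutations *)

Definition smooth_recurrence (R : realType) (m : nat) (p : nat -> R) : Prop :=
  (forall n, (n <= m)%N -> p n = 1) /\
  (forall n, (n + m)%:R * p (n + m)%N = \sum_(i < m) p (n + i)%N).

Lemma prob_smoothE (R : realType) m n :
  prob_smooth R n m = (smooth_count m n)%:R / n`!%:R.
Proof.
rewrite /prob_smooth /Defs.uniform_prob /smooth_count; congr (_%:R / _%:R).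
  rewrite -[RHS]cardsE; apply: eq_card => s; rewrite !inE.
  apply/forall_inP/andP => [h|[_ /forallP h] _ /imsetP[x _ ->] //].
  split; first by apply/fintype.subsetP => x _; rewrite inE.
  by apply/forallP => x; apply: h; apply: imset_f.
by rewrite card_Sn.
Qed.

(** After division by [n!], the [(n-1)(n-2)...(n-j+1)] ways of completing a cycle of
length [j] through a given point leave the same weight [1/n] for every [j]. *)
Lemma prob_smooth_recurrence (R : realType) m : (0 < m)%N ->
  smooth_recurrence m (fun n => prob_smooth R n m).
Proof.
move=> m0; split=> n.
  move=> nm; rewrite /prob_smooth /Defs.uniform_prob.
  have -> : #|@smooth_perm m n| = #|{: 'S_n}|.
    apply: eq_card => s; rewrite !inE; apply/forall_inP => c /imsetP[x _ ->].
    by rewrite (leq_trans (max_card _)) // card_ord.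
  by rewrite card_Sn divff // pnatr_eq0 -lt0n fact_gt0.
case: m m0 => // m _; rewrite addnS prob_smoothE smooth_countS //.
rewrite factS natrM invfM mulrCA mulVKf ?pnatr_eq0 //.
rewrite natr_sum mulr_suml (reindex_inj rev_ord_inj) /=.
apply: eq_bigr => i _; have im : (m - i <= n + m)%N by lia.
rewrite prob_smoothE subSS natrM.
rewrite (_ : n + m - (m - i) = n + i)%N; last by have := ltn_ord i; lia.
have -> : (n + m)`!%:R = ((n + m) ^_ (m - i))%:R * (n + i)`!%:R :> R.
  rewrite -natrM -(ffact_fact im); congr (_ * _`!)%:R.
  by have := ltn_ord i; lia.
have a0 : ((n + m) ^_ (m - i))%:R != 0 :> R.
  by rewrite pnatr_eq0 -lt0n ffact_gt0.
by rewrite invfM mulrACA mulfV // mul1r.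
Qed.

(** Induction on the index. The recurrence at [n = 0] would concern [f m <= g m],
which is already an initial condition; in [smooth_le_dickman] the corresponding
argument [m / (m + 1)] is below 1, outside the range of the delay equation. *)
Lemma recurrence_le (R : realType) m (f g : nat -> R) : (0 < m)%N ->
  (forall n, (n <= m)%N -> f n <= g n) ->
  (forall n, (0 < n)%N -> (n + m)%:R * f (n + m)%N <= \sum_(i < m) f (n + i)%N) ->
  (forall n, (0 < n)%N -> \sum_(i < m) g (n + i)%N <= (n + m)%:R * g (n + m)%N) ->
  forall n, f n <= g n.
Proof.
move=> m0 fg0 fS gS; elim/ltn_ind => n IH.
have [/fg0//|mn] := leqP n m.
have n0 : (0 < n - m)%N by rewrite subn_gt0.
have := fS _ n0; have := gS _ n0; rewrite subnK; last exact: ltnW.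
move=> gn fn; rewrite -(@ler_pM2l _ n%:R) ?ltr0n ?(leq_trans _ mn) //.
apply: le_trans fn (le_trans _ gn); apply: ler_sum => i _; apply: IH.
by have := ltn_ord i; lia.
Qed.

(** * The Dickman function *)

Section Dickman.
Variables (R : realType) (rho : R -> R).
Hypothesis rhoP : is_dickman rho.

Lemma dickman_nonincreasing (s t : R) : 0 <= s -> s <= t -> rho t <= rho s.
Proof.
have antitone1 (x y : R) : 1 <= x -> x <= y -> rho y <= rho x.
  apply: ler0_derive1_nincry => [z|z|].
  - by rewrite in_itv /= andbT; apply: dickman_derivable.
  - rewrite in_itv /= andbT => z1; have := dickman_eq rhoP z1.
    have /andP[] := dickman_range rhoP (t := z - 1) ltac:(lra).
    by move=> r0 _ e; rewrite -(pmulr_rle0 _ (lt_trans ltr01 z1)); lra.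
  - apply: continuous_subspaceW (dickman_continuous rhoP) => z /=.
    by rewrite in_itv /= andbT; lra.
move=> s0 st; have [s1|s1] := leP s 1; last by apply: antitone1; lra.
rewrite (dickman_eq1 rhoP (t := s)) ?s0 //.
by have /andP[] := dickman_range rhoP (le_trans s0 st).
Qed.

(** The integrated form of the delay equation: [t rho t - (G t - G (t - 1))] has
derivative zero for [t > 1] and vanishes at [t = 1]. *)
Lemma dickman_primitive : exists G : R -> R,
  [/\ forall a b, 0 <= a -> a <= b ->
        rho b * (b - a) <= G b - G a <= rho a * (b - a)
    & forall t, 1 <= t -> t * rho t = G t - G (t - 1)].
Proof.
(* Continuity of [rho] is only one-sided at 0; the constant extension to the left
   is continuous everywhere, and integrating it from -1 makes [G] differentiable
   at 0 as well. *)
pose f (t : R) := rho (Num.max 0 t).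
have max0 (t : R) : 0 <= Num.max 0 t by rewrite le_max lexx.
have fE (t : R) : 0 <= t -> f t = rho t by move=> t0; rewrite /f max_r.
have cf : continuous f.
  move=> t; apply: (@cvg_comp _ _ _ (fun t => Num.max 0 t) rho (nbhs t)
    (within [set t : R | 0 <= t] (nbhs (Num.max 0 t)))); last first.
    apply: (subspace_continuousP _ _).1 (dickman_continuous rhoP) _ _.
    exact: max0.
  have cmax : (fun t => Num.max 0 t) @ nbhs t --> nbhs (Num.max 0 t).
    apply: (@continuous_max _ _ (fun=> 0) id); [exact: cvg_cst|exact: cvg_id].
  move=> U /cmax; rewrite !nbhs_simpl /=; apply: filterS => x; apply.
  exact: max0.
pose G (x : R) := \int[lebesgue_measure]_(s in `[-1, x]) f s.
have dG (x : R) : 0 <= x -> is_derive x 1 G (f x).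
  move=> x0; have [||||dGx <-] := @continuous_FTC1_closed R f (-1) x (x + 1).
  - by rewrite ltrDl.
  - apply: continuous_compact_integrable; first exact: segment_compact.
    exact: continuous_subspaceT.
  - lra.
  - exact: cf.
  - by rewrite derive1E; apply: derivableP.
have cG (x : R) : 0 <= x -> {for x, continuous G}.
  by move=> /dG[dGx _]; apply/differentiable_continuous/derivable1_diffP.
have cGw a b : 0 <= a -> {within `[a, b], continuous G}.
  move=> a0; apply/subspace_continuousP => x /=; rewrite in_itv /= => /andP[ax _].
  by apply: cvg_within_filter; apply: cG; lra.
exists G; split=> [a b a0 ab|t t1].
  have [z|c] := @MVT_segment R G f a b ab _ (cGw _ _ a0).
    by rewrite in_itv /= => /andP[az _]; apply: dG; lra.
  rewrite in_itv /= => /andP[ac cb] ->; have ba : 0 <= b - a by lra.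
  by rewrite fE ?(le_trans a0) // !ler_wpM2r // dickman_nonincreasing //; lra.
pose F (t : R) := t * f t - (G t - G (t - 1)).
have F1 : F 1 = 0.
  have [z|c] := @MVT_segment R G f 0 1 ler01 _ (cGw _ _ (lexx 0)).
    by rewrite in_itv /= => /andP[az _]; apply: dG; lra.
  rewrite in_itv /= => c01; rewrite /F subrr => ->.
  rewrite !fE ?ler01 //; last by lra.
  by rewrite !(dickman_eq1 rhoP) ?lexx ?ler01 // ; lra.
suff : F t = 0 by rewrite /F fE; [move/eqP; rewrite subr_eq0 => /eqP|lra].
have dF (x : R) : x \in `]1, t[ -> is_derive x 1 F 0.
  rewrite in_itv /= => /andP[x1 _].
  have df : is_derive x 1 f (derive1 rho x).
    have -> : derive1 rho x = 'D_1 rho x by rewrite derive1E.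
    apply: (@near_eq_is_derive _ _ _ rho); rewrite ?oner_neq0 //; last first.
      exact/derivableP/(dickman_derivable rhoP).
    near=> y; rewrite fE //.
    by apply: ltW; near: y; apply: lt_nbhsr; lra.
  have dG1 := is_derive1_comp (dG (shift (-1) x) ltac:(rewrite /shift /=; lra))
    (is_derive_shift x 1 (-1)).
  have dGx := dG x ltac:(lra).
  have := is_deriveB (is_deriveM (is_derive_id x 1) df) (is_deriveB dGx dG1).
  congr (is_derive _ _ _ _); rewrite -[RHS](dickman_eq rhoP x1) mulr1 /shift /=.
  by rewrite !fE /GRing.scale /=; lra.
have [|c _] := @MVT_segment R F (fun=> 0) 1 t t1 dF.
  apply/subspace_continuousP => x /=; rewrite in_itv /= => /andP[x1 _].
  apply: cvg_within_filter; apply: cvgB.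
    by apply: cvgM; [exact: cvg_id|exact: cf].
  apply: cvgB; first by apply: cG; lra.
  apply: (@cvg_comp _ _ _ (fun x => x - 1) G _ (nbhs (x - 1))).
    by apply: cvgB; [exact: cvg_id|exact: cvg_cst].
  by apply: cG; lra.
by rewrite F1 subr0 mul0r.
Unshelve. all: by end_near.
Qed.

End Dickman.

(** * Smooth permutations between two dilates of the Dickman function *)

Section Sandwich.
Variables (R : realType) (rho : R -> R) (m : nat) (p : nat -> R).
Hypotheses (rhoP : is_dickman rho) (m0 : (0 < m)%N) (pP : smooth_recurrence m p).

Lemma dickman_small (q n : nat) : (n <= q)%N -> (0 < q)%N -> rho (n%:R / q%:R) = 1.
Proof.
move=> nq q0; apply: (dickman_eq1 rhoP).
by rewrite divr_ge0 ?ler0n // ler_pdivrMr ?ltr0n // mul1r ler_nat.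
Qed.

(** Lower and upper Riemann sums, with mesh [1/q], of the integral of [rho] over
the unit interval ending at [(n + q)/q]. *)
Lemma dickman_sum (q n : nat) : (0 < q)%N ->
  \sum_(i < q) rho ((n + i).+1%:R / q%:R) <= (n + q)%:R * rho ((n + q)%:R / q%:R)
    <= \sum_(i < q) rho ((n + i)%:R / q%:R).
Proof.
move=> q0; have [G [Gle GE]] := dickman_primitive rhoP.
have qR : 0 < q%:R :> R by rewrite ltr0n.
have -> : (n + q)%:R * rho ((n + q)%:R / q%:R) =
    \sum_(i < q) q%:R * (G ((n + i).+1%:R / q%:R) - G ((n + i)%:R / q%:R)).
  rewrite -mulr_sumr -(big_mkord xpredT
    (fun i => G ((n + i).+1%:R / q%:R) - G ((n + i)%:R / q%:R))).
  rewrite (@telescope_sumr_eq _ 0 q (fun i => G ((n + i)%:R / q%:R))) //; last first.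
    by move=> i _; rewrite addnS.
  rewrite addn0; set t := (n + q)%:R / q%:R.
  have tE : n%:R / q%:R = t - 1 by rewrite /t natrD mulrDl divff ?gt_eqF // addrK.
  rewrite tE -GE /t; first by rewrite mulrA [_ * (_ / _)]mulrC divfK // gt_eqF.
  by rewrite ler_pdivlMr // mul1r ler_nat leq_addl.
have step i : (n + i)%:R / q%:R <= (n + i).+1%:R / q%:R :> R.
  by rewrite ler_pM2r ?invr_gt0 // ler_nat.
have d i : (n + i).+1%:R / q%:R - (n + i)%:R / q%:R = q%:R^-1 :> R.
  by rewrite -mulrBl -natr1 addrAC subrr add0r mul1r.
by apply/andP; split; apply: ler_sum => i _; have /andP[] := Gle _ _
    (divr_ge0 (ler0n R (n + i)) (ltW qR)) (step i); rewrite d => h1 h2;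
  [rewrite [leRHS]mulrC -ler_pdivrMr | rewrite [leLHS]mulrC -ler_pdivlMr].
Qed.

Lemma dickman_le_smooth n : rho (n%:R / m%:R) <= p n.
Proof.
case: pP => p1 pS.
apply: (recurrence_le (f := fun n => rho (n%:R / m%:R)) m0) n => n.
- by move=> nm; rewrite p1 // dickman_small.
- by move=> _; have /andP[] := dickman_sum n m0.
- by rewrite pS.
Qed.

(** The lower Riemann sum with mesh [1/(m+1)] has [m+1] terms. The last one is the
value of [rho] at the right end point; it is nonnegative, and the other [m] terms
are exactly those of the recurrence of [p]. *)
Lemma smooth_le_dickman n : p n <= rho (n%:R / m.+1%:R).
Proof.
case: pP => p1 pS.
apply: (recurrence_le (g := fun n => rho (n%:R / m.+1%:R)) m0) n => n.
- by move=> nm; rewrite p1 // dickman_small // ltnW.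
- by rewrite pS.
case: n => // n _; have /andP[+ _] := dickman_sum n (ltn0Sn m).
rewrite big_ord_recr /= -addSn -addSnnS => h.
have r0 : 0 < rho ((n.+1 + m)%:R / m.+1%:R).
  by have /andP[] := dickman_range rhoP (t := (n.+1 + m)%:R / m.+1%:R)
       ltac:(by rewrite divr_ge0 ?ler0n).
apply: le_trans h; rewrite lerDl; exact: ltW.
Qed.

End Sandwich.

(** * Log-concavity and the ratio of consecutive terms *)

Section LogConcave.
Variables (R : realType) (m : nat) (p : nat -> R).
Hypotheses (m0 : (0 < m)%N) (pP : smooth_recurrence m p).

Lemma smooth_gt0 n : 0 < p n.
Proof.
case: pP => p1 pS; elim/ltn_ind: n => n IH.
have [/p1->//|mn] := leqP n m.
rewrite -(@pmulr_rgt0 _ n%:R) ?ltr0n ?(leq_trans _ mn) //.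
rewrite -{1 2}(subnK (ltnW mn)) pS; case: m m0 mn IH => // k _ kn IH.
rewrite big_ord_recl ltr_pwDl //; first by apply: IH; rewrite addn0; lia.
by apply: sumr_ge0 => i _; apply/ltW/IH; have := ltn_ord i; rewrite /= /bump; lia.
Qed.

(** Subtracting two consecutive instances of the recurrence makes the sums
telescope. *)
Lemma smooth_diff n :
  (n + m).+1%:R * (p (n + m)%N - p (n + m).+1) = p n.
Proof.
case: pP => _ pS; have := pS n.+1; have := pS n; rewrite addSn.
have -> : \sum_(i < m) p (n + i)%N = p n + \sum_(i < m.-1) p (n.+1 + i)%N.
  case: m m0 => // k _; rewrite big_ord_recl addn0; congr (_ + _).
  by apply: eq_bigr => i _; rewrite addSnnS.
have -> : \sum_(i < m) p (n.+1 + i)%N =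
    \sum_(i < m.-1) p (n.+1 + i)%N + p (n + m)%N.
  by case: m m0 => // k _; rewrite big_ord_recr /= addSnnS.
by rewrite -natr1; lra.
Qed.

Lemma smooth_nonincreasing : {homo p : i j / (i <= j)%N >-> j <= i}.
Proof.
apply: (@homo_leq _ _ (fun x y => y <= x)) => [x|y x z yx zy|i];
  [exact: lexx|exact: le_trans zy yx|].
case: pP => p1 _; have [im|mi] := ltnP i m; first by rewrite !p1 // ltnW.
rewrite -subr_ge0 -(@pmulr_rge0 _ i.+1%:R) ?ltr0n //.
by rewrite -{1 2 3}(subnK mi) smooth_diff ltW // smooth_gt0.
Qed.

Lemma smooth_le1 n : p n <= 1.
Proof. by case: pP => p1 _; rewrite -(p1 0%N) // smooth_nonincreasing. Qed.

Definition drop_ratio n := p n / p n.+1.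

(** The right-hand side involves [p] only up to [n + m], that is, only the ratios of
index less than [n + m]; this is what makes the induction of
[drop_ratio_nondecreasing] work. *)
Lemma drop_ratioE n :
  drop_ratio (n + m) = 1 + p n / \sum_(i < m) p (n.+1 + i)%N.
Proof.
have := smooth_gt0 (n + m).+1; have := smooth_diff n; rewrite /drop_ratio.
case: pP => _ /(_ n.+1) <-; rewrite addSn => <- p0.
by field; rewrite gt_eqF //= addrC natr1 pnatr_eq0.
Qed.

(** Log-concavity of [p]. By [drop_ratioE] the step from [n + m] to [n + m + 1]
amounts to [p n * p (n + 2 + i) <= p (n + 1) * p (n + 1 + i)] summed over
[i < m], and each of these inequalities compares two ratios of index at most
[n + m]. *)
Lemma drop_ratio_nondecreasing : {homo drop_ratio : i j / (i <= j)%N >-> i <= j}.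
Proof.
have p0 := smooth_gt0.
have sub0 K : (forall k, (k < K)%N -> drop_ratio k <= drop_ratio k.+1) ->
    forall i j, (i <= j <= K)%N -> drop_ratio i <= drop_ratio j.
  move=> h i j /andP[]; elim: j => [|j IH]; first by rewrite leqn0 => /eqP->.
  rewrite leq_eqVlt ltnS => /predU1P[->//|ij jK].
  exact: le_trans (IH ij (ltnW jK)) (h _ jK).
suff step k : drop_ratio k <= drop_ratio k.+1.
  by move=> i j ij; apply: (sub0 j) => //; rewrite ij leqnn.
elim/ltn_ind: k => k /sub0 IH; have [km|mk] := ltnP k m.
  case: pP => p1 _; rewrite {1}/drop_ratio !p1 ?(ltnW km) // divr1.
  by rewrite /drop_ratio ler_pdivlMr // mul1r smooth_nonincreasing.
set n := (k - m)%N; have kE : k = (n + m)%N by rewrite subnK.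
have S0 l : 0 < \sum_(i < m) p (l + i)%N.
  case: m m0 => // j _; rewrite big_ord_recl ltr_pwDl // sumr_ge0 // => i _.
  exact: ltW.
rewrite kE -addSn !drop_ratioE lerD2l ler_pdivrMr // mulrAC ler_pdivlMr //.
rewrite !mulr_sumr; apply: ler_sum => i _.
have : drop_ratio n <= drop_ratio (n.+1 + i).
  by apply: IH; rewrite kE; have := ltn_ord i; lia.
rewrite /drop_ratio ler_pdivrMr // mulrAC ler_pdivlMr //.
by rewrite addSn [leRHS]mulrC.
Qed.

Lemma drop_ratio_pow_le n k : drop_ratio n ^+ k * p (n + k)%N <= p n.
Proof.
elim: k => [|k IH]; first by rewrite expr0 mul1r addn0.
apply: le_trans IH; rewrite exprSr -mulrA ler_pM2l; last first.
  by rewrite exprn_gt0 // divr_gt0 // smooth_gt0.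
rewrite addnS -ler_pdivlMr ?smooth_gt0 //.
exact: drop_ratio_nondecreasing (leq_addr _ _).
Qed.

Lemma le_drop_ratio_pow n k : p n <= drop_ratio (n + k) ^+ k * p (n + k)%N.
Proof.
elim: k n => [|k IH] n; first by rewrite expr0 mul1r addn0.
have d0 l : 0 < drop_ratio l by rewrite divr_gt0 // smooth_gt0.
have := IH n.+1; rewrite addSnnS => h.
rewrite exprS -mulrA; apply: le_trans (ler_wpM2l (ltW (d0 _)) h).
rewrite -ler_pdivrMr ?smooth_gt0 //.
exact: drop_ratio_nondecreasing (leq_addr _ _).
Qed.

(** At least half of the terms of the recurrence for [p n] have index at most
[n - m/2], so going down by about [m/2] costs a factor of at most [2n/m]. *)
Lemma smooth_half_step n : (m < n)%N ->
  exists2 h, (0 < h <= n)%N /\ (m <= h.*2)%N &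
    m%:R * p (n - h)%N <= 2 * (n%:R * p n).
Proof.
move=> mn.
(* Keep the [k] smallest indices [n - m, ..., n - m + k - 1]. *)
pose k := uphalf m.
have k0 : (0 < k)%N by rewrite /k; lia.
have mk : (m <= k.*2)%N by rewrite /k; lia.
have km : (k.*2 <= m.+1)%N by rewrite /k; lia.
exists (m - k.-1)%N; first by split; lia.
have pn := smooth_gt0; case: pP => _ /(_ (n - m)%N); rewrite subnK ?(ltnW mn) // => nE.
rewrite {}nE; apply: (@le_trans _ _ (2 * (k%:R * p (n - (m - k.-1))%N))).
  by rewrite mulrA -natrM ler_pM2r // ler_nat mul2n.
rewrite ler_pM2l //.
have kmm : (k <= m)%N by lia.
rewrite -(big_mkord xpredT (fun i => p (n - m + i)%N)) (big_cat_nat (leq0n k) kmm) //=.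
rewrite -[leLHS]addr0 lerD //; last by apply: sumr_ge0 => i _; apply: ltW.
rewrite big_mkord mulr_natl -[X in _ *+ X]card_ord -sumr_const.
by apply: ler_sum => i _; apply: smooth_nonincreasing; have := ltn_ord i; lia.
Qed.

(** About [2n/m] applications of [smooth_half_step], each costing a factor of at
most [2N/m]. *)
Lemma smooth_lower n N : (m <= N)%N -> (n <= N)%N ->
  expR (- ((2 * n%:R) / m%:R * ln ((2 * N%:R) / m%:R))) <= p n.
Proof.
have mR : 0 < m%:R :> R by rewrite ltr0n.
move=> mN; set L := ln _.
have e2 : m%:R / (2 * N%:R) = expR (- L) :> R.
  rewrite expRN lnK ?invf_div // posrE divr_gt0 // mulr_gt0 // ltr0n.
  exact: leq_trans mN.
have L0 : 0 <= L.
  apply: ln_ge0; rewrite ler_pdivlMr // mul1r -natrM ler_nat; lia.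
elim/ltn_ind: n => n IH nN; have [nm|mn] := leqP n m.
  case: pP => /(_ n nm) -> _; rewrite -expR0 ler_expR oppr_le0.
  by rewrite mulr_ge0 // divr_ge0 ?mulr_ge0.
(* A step of length at least [m/2] lowers the exponent [2n/m] by at least 1. *)
have [h [/andP[h0 hn] mh] hp] := smooth_half_step mn.
have NR : 0 < N%:R :> R by rewrite ltr0n (leq_trans _ mN).
have := IH (n - h)%N ltac:(lia) ltac:(lia); set E := expR _ => hE.
have h1 : expR (- L) * E <= p n.
  rewrite -e2 mulrAC ler_pdivrMr ?mulr_gt0 //.
  apply: le_trans (_ : m%:R * p (n - h)%N <= _); first by rewrite ler_pM2l.
  apply: le_trans hp _; rewrite [leRHS]mulrC mulrA ler_pM2r ?smooth_gt0 //.
  by rewrite ler_pM2l // ler_nat.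
apply: le_trans h1; rewrite /E -expRD ler_expR natrB //.
have hm : 1 <= 2 * h%:R / m%:R :> R.
  by rewrite ler_pdivlMr // mul1r -natrM ler_nat mul2n.
have := ler_wpM2r L0 hm; rewrite mulrBr mulrBl mulrBl; lra.
Qed.

(** The ratio at [n] is at most each of the [n] ratios at [n, ..., 2n-1], whose
product is [p n / p (2n) <= 1 / p (2n)], and [smooth_lower] bounds the latter. *)
Lemma drop_ratio_le n : (m <= n)%N ->
  drop_ratio n <= expR (8%:R / m%:R * ln (n%:R / m%:R + 1)).
Proof.
move=> mn; have n0 : (0 < n)%N by apply: leq_trans mn.
have mR : 0 < m%:R :> R by rewrite ltr0n.
have nR : 0 < n%:R :> R by rewrite ltr0n.
have d0 : 0 < drop_ratio n by rewrite divr_gt0 // smooth_gt0.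
rewrite -(@ler_pXn2r _ n) // ?nnegrE ?expR_ge0 ?(ltW d0) //.
have := @smooth_lower (n + n) (n + n) ltac:(lia) ltac:(lia).
set v := (2 * _ / _) => lo.
have up : drop_ratio n ^+ n * p (n + n)%N <= 1.
  exact: le_trans (drop_ratio_pow_le _ _) (smooth_le1 _).
have {lo up} : drop_ratio n ^+ n <= expR (v * ln v).
  move: up; rewrite -ler_pdivlMr ?smooth_gt0 // => /le_trans; apply.
  by rewrite mul1r -[v * _]opprK expRN lef_pV2 // posrE ?smooth_gt0 ?expR_gt0.
move=> /le_trans; apply; rewrite -expRM_natl ler_expR.
set u := n%:R / m%:R; have vE : v = 4%:R * u.
  by rewrite /v /u natrD mulrA; congr (_ / _); ring.
have u1 : 1 <= u by rewrite ler_pdivlMr // mul1r ler_nat.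
have -> : n%:R * (8%:R / m%:R * ln (u + 1)) = v * (2%:R * ln (u + 1)).
  by rewrite vE /u; ring.
rewrite vE ler_pM2l; last by lra.
rewrite [leRHS]mulr_natl -lnXn; last by lra.
rewrite ler_ln ?posrE ?exprn_gt0; try lra.
by have := sqr_ge0 (u - 1); lra.
Qed.

End LogConcave.

(** * Comparison of the two dilates *)

Theorem proposition1p8 (R : realType) :
  exists C : R, 0 < C /\
    forall (rho : R -> R), is_dickman rho ->
    forall n m : nat, (1 <= m)%N -> (m <= n)%N -> (2 <= n)%N ->
      let u : R := n%:R / m%:R in
      rho u * expR (- (C * (u * ln (u + 1) / m%:R))) <= prob_smooth R n m /\
      prob_smooth R n m <= rho u * expR (C * (u * ln (u + 1) / m%:R)).
Proof.
exists 16%:R; split=> // rho rhoP n m m0 mn _ u.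
have mR : 0 < m%:R :> R by rewrite ltr0n.
have u1 : 1 <= u by rewrite ler_pdivlMr // mul1r ler_nat.
have uE : u * m%:R = n%:R by rewrite divfK // gt_eqF.
have lnu : 0 <= ln (u + 1) by apply: ln_ge0; lra.
have pP := prob_smooth_recurrence R m0.
have /andP[r0 _] := dickman_range rhoP (le_trans ler01 u1).
split.
  apply: le_trans (dickman_le_smooth rhoP m0 pP n).
  rewrite ler_piMr ?(ltW r0) // -[leRHS]expR0 ler_expR oppr_le0.
  by rewrite mulr_ge0 // divr_ge0 // mulr_ge0 // (le_trans ler01 u1).
apply: le_trans (smooth_le_dickman rhoP m0 pP n) _.
(* With these choices [N / M = n / (m + 1)] and
   [(N + 2 * n) / (M + 1) = n / m] exactly. *)
pose M := ((m.*2).-1 * m.+1)%N; pose N := (n * (m.*2).-1)%N.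
have M0 : (0 < M)%N by rewrite muln_gt0; apply/andP; split; lia.
have qP := prob_smooth_recurrence R M0.
have ME : M.+1 = (m * (m.*2).+1)%N by rewrite /M; nia.
have NE : (N + n.*2 = n * (m.*2).+1)%N by rewrite /N; nia.
have -> : n%:R / m.+1%:R = N%:R / M%:R :> R.
  rewrite /N /M [(_ * m.+1)%N]mulnC !natrM -mulf_div divff ?mulr1 //.
  by rewrite pnatr_eq0; lia.
apply: le_trans (dickman_le_smooth rhoP M0 qP N) _.
apply: le_trans (le_drop_ratio_pow M0 qP N n.*2) _.
rewrite mulrC; apply: ler_pM.
- exact/ltW/(smooth_gt0 M0 qP).
- by rewrite exprn_ge0 // divr_ge0 // ltW // (smooth_gt0 M0 qP).
- apply: le_trans (smooth_le_dickman rhoP M0 qP _) _.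
  rewrite NE ME !natrM -mulf_div divff ?mulr1 // pnatr_eq0.
have MN : (M <= N + n.*2)%N by rewrite NE (leq_trans (leqnSn M)) // ME leq_mul.
have := drop_ratio_le M0 qP MN.
move=> /(lerXn2r n.*2); rewrite !nnegrE expR_ge0 => /(_ _ isT) hle.
apply: le_trans (hle _) _; first by rewrite divr_ge0 // ltW // (smooth_gt0 M0 qP).
rewrite -expRM_natl ler_expR.
set w := _ / M%:R + 1.
have MR : 0 < M%:R :> R by rewrite ltr0n.
have Mge : (m * m * 2 <= M)%N by rewrite /M; nia.
have wu : w <= (u + 1) ^+ 2.
  rewrite /w; apply: (@le_trans _ _ (u *+ 2 + 1)); last first.
    by have := sqr_ge0 u; lra.
  rewrite lerD2r ler_pdivrMr // -(ler_pM2r mR).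
  have -> : u *+ 2 * M%:R * m%:R = 2 * n%:R * M%:R by rewrite -uE; ring.
  by rewrite -!natrM ler_nat NE /M; nia.
have w1 : 1 <= w by rewrite /w lerDr divr_ge0.
have lw : ln w <= ln (u + 1) *+ 2.
  rewrite -lnXn; last by lra.
  by rewrite ler_ln ?posrE ?exprn_gt0; lra.
have lw0 : 0 <= ln w by apply: ln_ge0.
have c : n.*2%:R * (8%:R / M%:R) <= 8%:R * u / m%:R.
  rewrite mulrA ler_pdivrMr // mulrAC ler_pdivlMr // -(ler_pM2r mR).
  have -> : 8%:R * u * M%:R * m%:R = 8%:R * n%:R * M%:R.
    by rewrite -uE; ring.
  rewrite -!natrM ler_nat (_ : n.*2 * 8 * m * m = 8 * n * (m * m * 2))%N.
    by rewrite leq_mul2l Mge orbT.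
  by rewrite -muln2; ring.
rewrite [leLHS]mulrA; apply: le_trans (ler_pM _ lw0 c lw) _.
  by rewrite mulr_ge0 // divr_ge0.
by rewrite -mulr_natr; lra.
Qed.
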